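(* Let $\mathcal{H}$ be a finite-dimensional real, complex or quaternionic Hilbert space, and let $\mathcal{H}-\{0\}$ be equipped with the Riemannian metric $$g_x(v,w)=\mathrm{Re}\Big(\frac{2}{\|x\|}\langle v,w\rangle-\frac{1}{\|x\|^3}\langle v,x\rangle\langle x,w\rangle\Big).$$ Let $\mathbb{R}\oplus\mathcal{H}\oplus\mathcal{L}(\mathcal{H})_{\text{self-adjoint}}$ be equipped with the Riemannian metric $$\frac52 g_{\mathbb{R}}\oplus g_{\mathcal{H}}\oplus\frac12 g_{\mathcal{L}(\mathcal{H})}.$$ Then $$(\mathcal{H}-\{0\},g)\to\mathbb{R}\oplus\mathcal{H}\oplus\mathcal{L}(\mathcal{H})_{\text{self-adjoint}},\qquad x\mapsto\|x\|^{1/2}\big(1,\ \|x\|^{-1}x,\ \|x\|^{-2}xx^*\big)$$ is an isometric embedding.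
   Context: The inner product is conjugate-linear in the first slot and linear in the second (for quaternionic spaces, $\mathcal{H}$ is a right $\mathbb{H}$-module). $\mathcal{L}(\mathcal{H})$ is the space of linear operators on $\mathcal{H}$ and $\mathcal{L}(\mathcal{H})_{\text{self-adjoint}}$ its real subspace of self-adjoint operators. For $x,y\in\mathcal{H}$, $xy^*\in\mathcal{L}(\mathcal{H})$ is the operator sending $z$ to $\langle y,z\rangle x$ (that is, $x\langle y,z\rangle$ in the right-module convention). $g_{\mathbb{R}}$ is the standard metric on $\mathbb{R}$; $g_{\mathcal{H}}(v,w)=\mathrm{Re}\langle v,w\rangle$ is the translation-invariant metric; $g_{\mathcal{L}(\mathcal{H})}$ is the real part of the Hilbert–Schmidt inner product, characterized by $g_{\mathcal{L}(\mathcal{H})}(xy^*,wz^* )=\mathrm{Re}(\langle x,w\rangle\langle z,y\rangle)$. *)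

(* Defs.v *)
From HB Require Import structures.
From mathcomp Require Import all_boot all_order all_algebra.
From mathcomp Require Import all_classical all_reals all_analysis.
From mathcomp Require Import complex ring lra.

Set Implicit Arguments.
Unset Strict Implicit.
Unset Printing Implicit Defensive.

Import Order.TTheory GRing.Theory Num.Theory.
Import numFieldNormedType.Exports.

Local Open Scope classical_set_scope.
Local Open Scope ring_scope.

(* [Quat a b c d] is a + b i + c j + d k. *)
Record quaternion (R : Type) := Quat { quat0 : R; quat1 : R; quat2 : R; quat3 : R }.

Section QuaternionRing.
Variable R : realType.
Local Notation H := (quaternion R).

Let to_tuple (x : H) := (quat0 x, quat1 x, quat2 x, quat3 x).
Let of_tuple (x : R * R * R * R) : H := Quat x.1.1.1 x.1.1.2 x.1.2 x.2.
Let to_tupleK : cancel to_tuple of_tuple. Proof. by case. Qed.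

HB.instance Definition _ := Choice.copy H (can_type to_tupleK).

Definition quat_add (x y : H) : H :=
  Quat (quat0 x + quat0 y) (quat1 x + quat1 y) (quat2 x + quat2 y) (quat3 x + quat3 y).
Definition quat_opp (x : H) : H :=
  Quat (- quat0 x) (- quat1 x) (- quat2 x) (- quat3 x).
Definition quat_real (a : R) : H := Quat a 0 0 0.
Definition quat_mul (x y : H) : H :=
  let: Quat a b c d := x in let: Quat a' b' c' d' := y in
  Quat (a * a' - b * b' - c * c' - d * d')
       (a * b' + b * a' + c * d' - d * c')
       (a * c' - b * d' + c * a' + d * b')
       (a * d' + b * c' - c * b' + d * a').
Definition quat_conj (x : H) : H :=
  Quat (quat0 x) (- quat1 x) (- quat2 x) (- quat3 x).

Let addA : associative quat_add.
Proof. by move=> [? ? ? ?] [? ? ? ?] [? ? ? ?]; congr Quat; exact: addrA. Qed.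
Let addC : commutative quat_add.
Proof. by move=> [? ? ? ?] [? ? ? ?]; congr Quat; exact: addrC. Qed.
Let add0 : left_id (quat_real 0) quat_add.
Proof. by move=> [? ? ? ?]; congr Quat; exact: add0r. Qed.
Let addN : left_inverse (quat_real 0) quat_opp quat_add.
Proof. by move=> [? ? ? ?]; congr Quat; exact: addNr. Qed.

HB.instance Definition _ := GRing.isZmodule.Build H addA addC add0 addN.

Let mulA : associative quat_mul.
Proof. by move=> [? ? ? ?] [? ? ? ?] [? ? ? ?]; congr Quat; ring. Qed.
Let mul1 : left_id (quat_real 1) quat_mul.
Proof. by move=> [? ? ? ?]; congr Quat; ring. Qed.
Let mulr1 : right_id (quat_real 1) quat_mul.
Proof. by move=> [? ? ? ?]; congr Quat; ring. Qed.
Let mulDl : left_distributive quat_mul +%R.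
Proof. by move=> [? ? ? ?] [? ? ? ?] [? ? ? ?]; congr Quat; rewrite /=; ring. Qed.
Let mulDr : right_distributive quat_mul +%R.
Proof. by move=> [? ? ? ?] [? ? ? ?] [? ? ? ?]; congr Quat; rewrite /=; ring. Qed.
Let one_neq0 : quat_real 1 != 0.
Proof. by apply/eqP => -[/eqP]; rewrite oner_eq0. Qed.

HB.instance Definition _ :=
  GRing.Zmodule_isNzRing.Build H mulA mul1 mulr1 mulDl mulDr one_neq0.

End QuaternionRing.

Inductive scalar_kind := KReal | KComplex | KQuaternion.

Definition scalars (R : realType) (k : scalar_kind) : nzRingType :=
  match k with KReal => R | KComplex => R[i] | KQuaternion => quaternion R end.

Definition sconj (R : realType) (k : scalar_kind) : scalars R k -> scalars R k :=
  match k with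
  | KReal => id
  | KComplex => @conjc R
  | KQuaternion => @quat_conj R
  end.

Definition sRe (R : realType) (k : scalar_kind) : scalars R k -> R :=
  match k with
  | KReal => id
  | KComplex => @complex.Re R
  | KQuaternion => @quat0 R
  end.

Definition sreal (R : realType) (k : scalar_kind) : R -> scalars R k :=
  match k with
  | KReal => id
  | KComplex => real_complex R
  | KQuaternion => @quat_real R
  end.
Arguments sreal {R} k a.

Section ScalarTheory.
Variables (R : realType) (k : scalar_kind).
Implicit Types (a b : scalars R k) (r s : R).

Lemma sRe_is_additive : zmod_morphism (@sRe R k).
Proof. by case: k => //= [] [? ?] [? ?]. Qed.
HB.instance Definition _ :=
  GRing.isZmodMorphism.Build (scalars R k) R (@sRe R k) sRe_is_additive.

Lemma sreal_is_additive : zmod_morphism (@sreal R k).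
Proof.
case: k => //= r s; first exact: rmorphB.
by congr Quat; rewrite /= oppr0 addr0.
Qed.
HB.instance Definition _ :=
  GRing.isZmodMorphism.Build R (scalars R k) (@sreal R k) sreal_is_additive.

Lemma sconj_is_additive : zmod_morphism (@sconj R k).
Proof.
case: k => //= x y; first exact: rmorphB.
by congr Quat; rewrite /= opprD.
Qed.
HB.instance Definition _ :=
  GRing.isZmodMorphism.Build (scalars R k) (scalars R k) (@sconj R k)
    sconj_is_additive.

Lemma sconjM a b : sconj (a * b) = sconj b * sconj a.
Proof.
case: k a b => /= [a b|a b|[? ? ? ?] [? ? ? ?]]; first exact: mulrC.
  by rewrite rmorphM mulrC.
by congr Quat; rewrite /=; ring.
Qed.

Lemma sconjK : involutive (@sconj R k).
Proof. by case: k => //= [[? ?]|[? ? ? ?]]; rewrite /= /quat_conj/= !opprK. Qed.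

Lemma sconj_real r : sconj (sreal k r) = sreal k r.
Proof. by case: k => [||] //=; rewrite /quat_real /quat_conj oppr0. Qed.

Lemma sRe_conj a : sRe (sconj a) = sRe a.
Proof. by case: k a => //= -[]. Qed.

Lemma sRe_real r : sRe (sreal k r) = r.
Proof. by case: k. Qed.

Lemma sreal1 : sreal k (1 : R) = 1.
Proof. by case: k. Qed.

Lemma srealM r s : sreal k (r * s) = sreal k r * sreal k s.
Proof.
case: k => //=; first exact: rmorphM.
by congr Quat; rewrite /=; ring.
Qed.

Lemma sreal_comm r a : sreal k r * a = a * sreal k r.
Proof.
case: k a => /= [a|a|[? ? ? ?]]; [exact: mulrC|exact: mulrC|].
by congr Quat; rewrite /=; ring.
Qed.

Lemma sReMC a b : sRe (a * b) = sRe (b * a).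
Proof.
by case: k a b => /= [a b|a b|[? ? ? ?] [? ? ? ?]]; rewrite 1?mulrC//=; ring.
Qed.

Lemma sReZ r a : sRe (sreal k r * a) = r * sRe a.
Proof. by case: k a => //= [[? ?]|[? ? ? ?]] /=; ring. Qed.

Lemma sconj_fixed a : sconj a = a -> a = sreal k (sRe a).
Proof.
have opp0 (x : R) : - x = x -> x = 0 by move=> ?; lra.
by case: k a => //= [[? ?] [/opp0 ->]|[? ? ? ?] [/opp0-> /opp0-> /opp0->]].
Qed.

End ScalarTheory.

(* A finite-dimensional space is automatically complete.  The scalars act on the
   right, which only matters for quaternions; the two real structures agree by
   [ract_real].  Definiteness of the inner product follows from [inner_norm]. *)
HB.mixin Record NormedModule_isFinHilbert (R : realType) (k : scalar_kind) V
    of NormedModule R V := {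
  ract : V -> scalars R k -> V;
  ractDl : forall (x y : V) a, ract (x + y) a = ract x a + ract y a;
  ractDr : forall (x : V) a b, ract x (a + b) = ract x a + ract x b;
  ractA : forall (x : V) a b, ract (ract x a) b = ract x (a * b);
  ract_real : forall (x : V) (r : R), ract x (sreal k r) = r *: x;
  inner : V -> V -> scalars R k;
  innerDr : forall x y z : V, inner x (y + z) = inner x y + inner x z;
  inner_ract : forall (x y : V) a, inner x (ract y a) = inner x y * a;
  inner_conj : forall x y : V, sconj (inner x y) = inner y x;
  inner_norm : forall x : V, `|x| ^+ 2 = sRe (inner x x);
  finitely_generated : exists s : seq V, forall x : V,
    exists c : nat -> scalars R k, x = \sum_(i < size s) ract s`_i (c i)
}.

#[short(type="finHilbertType")]
HB.structure Definition FinHilbert (R : realType) (k : scalar_kind) :=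
  {V of NormedModule R V & NormedModule_isFinHilbert R k V}.

Definition re_inner (R : realType) (k : scalar_kind) (V : finHilbertType R k)
  (x y : V) : R := sRe (inner x y).

Section HilbertTheory.
Variables (R : realType) (k : scalar_kind) (V : finHilbertType R k).
Implicit Types (x y z : V) (a b : scalars R k) (r : R).

Lemma ract0l a : ract (0 : V) a = 0.
Proof. by apply: (@addrI V (ract 0 a)); rewrite -ractDl !addr0. Qed.

Lemma ract1 x : ract x (1 : scalars R k) = x.
Proof. by rewrite -sreal1 ract_real scale1r. Qed.

Lemma ract0 x : ract x (0 : scalars R k) = 0.
Proof. by apply: (@addrI V (ract x 0)); rewrite -ractDr !addr0. Qed.

Lemma ractZ r x a : ract (r *: x) a = r *: ract x a.
Proof. by rewrite -!ract_real !ractA sreal_comm. Qed.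

Lemma inner_is_additive x : zmod_morphism (inner x).
Proof.
have i0 : inner x 0 = 0.
  by apply: (@addrI _ (inner x 0)); rewrite -innerDr !addr0.
move=> y z; rewrite innerDr; congr (_ + _).
by apply/eqP; rewrite -addr_eq0 -innerDr addNr i0.
Qed.

HB.instance Definition _ x :=
  GRing.isZmodMorphism.Build V (scalars R k) (inner x) (inner_is_additive x).

Lemma innerDl x y z : inner (x + y) z = inner x z + inner y z.
Proof. by rewrite -inner_conj innerDr raddfD /= !inner_conj. Qed.

Lemma innerBl x y z : inner (x - y) z = inner x z - inner y z.
Proof. by rewrite -inner_conj raddfB raddfB /= !inner_conj. Qed.

Lemma inner_ractl x y a : inner (ract x a) y = sconj a * inner x y.
Proof. by rewrite -inner_conj inner_ract sconjM inner_conj. Qed.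

Lemma inner_suml (I : Type) (s : seq I) (F : I -> V) y :
  inner (\sum_(i <- s) F i) y = \sum_(i <- s) inner (F i) y.
Proof.
rewrite -inner_conj raddf_sum raddf_sum /=.
by apply: eq_bigr => i _; rewrite inner_conj.
Qed.

Lemma innerZr r x y : inner x (r *: y) = sreal k r * inner x y.
Proof. by rewrite -ract_real inner_ract sreal_comm. Qed.

Lemma innerZl r x y : inner (r *: x) y = sreal k r * inner x y.
Proof. by rewrite -ract_real inner_ractl sconj_real. Qed.

Lemma inner_self x : inner x x = sreal k (`|x| ^+ 2).
Proof. by rewrite inner_norm; apply/sconj_fixed/inner_conj. Qed.

Lemma re_innerC x y : re_inner x y = re_inner y x.
Proof. by rewrite /re_inner -inner_conj sRe_conj. Qed.

Definition orthonormal_basis (e : seq V) : Prop :=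
  (forall i j, (i < size e)%N -> (j < size e)%N ->
     inner e`_i e`_j = (i == j)%:R) /\
  (forall x, x = \sum_(f <- e) ract f (inner f x)).

Let orthonormal (e : seq V) : Prop :=
  forall i j, (i < size e)%N -> (j < size e)%N -> inner e`_i e`_j = (i == j)%:R.

Let proj (e : seq V) x := \sum_(f <- e) ract f (inner f x).

Let projD e x y : proj e (x + y) = proj e x + proj e y.
Proof. by rewrite /proj -big_split; apply: eq_bigr => f _; rewrite /= innerDr ractDr. Qed.

Let proj_ract e x a : proj e (ract x a) = ract (proj e x) a.
Proof.
rewrite /proj (big_morph (fun y => ract y a) (fun y z => ractDl y z a) (ract0l a)).
by apply: eq_bigr => f _; rewrite inner_ract ractA.
Qed.

Let inner_proj e i x : orthonormal e -> (i < size e)%N ->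
  inner e`_i (proj e x) = inner e`_i x.
Proof.
move=> oe ie; rewrite /proj raddf_sum /= (big_nth 0) big_mkord.
rewrite (bigD1 (Ordinal ie)) //= inner_ract oe// eqxx mul1r big1 ?addr0//.
move=> j /eqP ji; rewrite inner_ract oe// (_ : (i == j) = false) ?mul0r//.
by apply/eqP => ij; apply: ji; exact: val_inj.
Qed.

Let gram_schmidt (s : seq V) : exists e, orthonormal e /\
  forall x, x \in s -> proj e x = x.
Proof.
elim: s => [|x s [e [oe es]]]; first by exists [::].
pose w := x - proj e x.
have ew i : (i < size e)%N -> inner e`_i w = 0.
  by move=> ie; rewrite raddfB /= inner_proj ?subrr.
have [w0|w0] := eqVneq w 0.
  exists e; split=> // y; rewrite inE => /predU1P[->|]; last exact: es.
  by apply/esym/eqP; rewrite -subr_eq0 -/w w0.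
pose u := `|w|^-1 *: w.
have uw : `|w| *: u = w by rewrite /u scalerA divff ?normr_eq0 ?scale1r.
have eu i : (i < size e)%N -> inner e`_i u = 0.
  by move=> ie; rewrite innerZr ew ?mulr0.
have uu : inner u u = 1.
  by rewrite inner_self /u normfZV// expr1n sreal1.
have ue i : (i < size e)%N -> inner u e`_i = 0.
  by move=> ie; rewrite -inner_conj eu ?raddf0.
have pcat z : proj (rcons e u) z = proj e z + ract u (inner u z).
  by rewrite /proj -cats1 big_cat big_seq1.
have up z : inner u (proj e z) = 0.
  rewrite /proj raddf_sum /= (big_nth 0) big_mkord big1// => i _.
  by rewrite inner_ract ue ?mul0r.
exists (rcons e u); split.
  move=> i j; rewrite size_rcons !ltnS !nth_rcons => ie je.
  have [ie'|ie'|ieE] := ltngtP i (size e); last 2 first.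
  - by move: ie; rewrite leqNgt ie'.
  - have [je'|je'|jeE] := ltngtP j (size e).
    + by rewrite ue// ieE gtn_eqF.
    + by move: je; rewrite leqNgt je'.
    + by rewrite uu ieE jeE eqxx.
  have [je'|je'|jeE] := ltngtP j (size e).
  - exact: oe.
  - by move: je; rewrite leqNgt je'.
  - by rewrite eu// jeE ltn_eqF.
move=> y; rewrite inE pcat => /predU1P[->|ys]; last first.
  by rewrite es// -{2}(es _ ys) up ract0 addr0.
have -> : inner u x = sreal k `|w|.
  have -> : x = w + proj e x by rewrite subrK.
  by rewrite innerDr up addr0 -[in LHS]uw innerZr uu mulr1.
by rewrite ract_real uw addrC subrK.
Qed.

Lemma exists_onb : exists e : seq V, orthonormal_basis e.
Proof.
have [s gen] := @finitely_generated R k V.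
have [e [oe es]] := gram_schmidt s; exists e; split=> // x.
have p0 : proj e 0 = 0 by apply: (@addrI V (proj e 0)); rewrite -projD !addr0.
have [c ->] := gen x; rewrite -/(proj e _).
rewrite (big_morph _ (projD e) p0); apply: eq_bigr => i _.
by rewrite proj_ract es ?mem_nth.
Qed.

Definition onb : seq V := sval (cid exists_onb).

Lemma onbP : orthonormal_basis onb.
Proof. exact: (svalP (cid exists_onb)). Qed.

End HilbertTheory.

Section Operators.
Variables (R : realType) (k : scalar_kind) (V : finHilbertType R k).
Implicit Types (x y z : V) (a b : scalars R k) (r : R).

(* Linearity over the scalars; real linearity follows by [ract_real]. *)
Definition is_linop (f : V -> V) : Prop :=
  (forall x y, f (x + y) = f x + f y) /\ (forall x a, f (ract x a) = ract (f x) a).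

Definition linop_pred : {pred V -> V} := fun f => `[< is_linop f >].

Lemma linop_submod_closed : submod_closed linop_pred.
Proof.
split.
  apply/asboolP; split=> [x y|x a] /=; first by rewrite addr0.
  by apply: (@addrI V (ract 0 a)); rewrite -ractDl !addr0.
move=> r f g /asboolP[fD fa] /asboolP[gD ga]; apply/asboolP; split=> [x y|x a].
  by rewrite !addrfctE !scalrfctE fD gD scalerDr addrACA.
by rewrite !addrfctE !scalrfctE fa ga ractDl ractZ.
Qed.
HB.instance Definition _ :=
  GRing.isSubmodClosed.Build R (V -> V) linop_pred linop_submod_closed.

Record linop := LinOp { linop_fun :> V -> V; linop_funP : linop_fun \in linop_pred }.
HB.instance Definition _ := [isSub for linop_fun].
HB.instance Definition _ := [Choice of linop by <:].
HB.instance Definition _ := [SubChoice_isSubLmodule of linop by <:].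

Implicit Types A B : linop.

Lemma linopD A x y : A (x + y) = A x + A y.
Proof. by case: A => f /= /asboolP[]. Qed.

Lemma linop_ract A x a : A (ract x a) = ract (A x) a.
Proof. by case: A => f /= /asboolP[]. Qed.

Lemma outer_subproof x y : (fun z => ract x (inner y z)) \in linop_pred.
Proof.
apply/asboolP; split=> [z w|z a]; first by rewrite innerDr ractDr.
by rewrite inner_ract ractA.
Qed.

(* x y^* *)
Definition outer x y : linop := LinOp (outer_subproof x y).

(* The real part of the Hilbert-Schmidt inner product.  The choice of orthonormal
   basis is immaterial: [re_hs_outer] determines this bilinear form, since the
   operators x y^* span. *)
Definition re_hs A B : R := \sum_(e <- onb V) re_inner (A e) (B e).

Lemma re_hs_outer x y w z :
  re_hs (outer x y) (outer w z) = sRe (inner x w * inner z y).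
Proof.
rewrite /re_hs [in RHS](proj2 (onbP V) y) raddf_sum mulr_sumr raddf_sum.
apply: eq_bigr => e _ /=.
rewrite /re_inner inner_ract inner_ractl -mulrA sReMC inner_conj.
by rewrite inner_ract mulrA.
Qed.

Definition selfadjoint A : Prop := forall x y, inner (A x) y = inner x (A y).

Definition selfadjoint_pred : {pred linop} := fun A => `[< selfadjoint A >].

Lemma selfadjoint_submod_closed : submod_closed selfadjoint_pred.
Proof.
split.
  apply/asboolP => x y; rewrite /= raddf0 -inner_conj.
  by rewrite [inner y _]raddf0 raddf0.
move=> r A B /asboolP sA /asboolP sB; apply/asboolP => x y.
by rewrite /= innerDl innerZl sA sB innerDr innerZr.
Qed.
HB.instance Definition _ :=
  GRing.isSubmodClosed.Build R linop selfadjoint_pred selfadjoint_submod_closed.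

Record saop := SAOp { saop_op :> linop; saop_opP : saop_op \in selfadjoint_pred }.
HB.instance Definition _ := [isSub for saop_op].
HB.instance Definition _ := [Choice of saop by <:].
HB.instance Definition _ := [SubChoice_isSubLmodule of saop by <:].

Lemma outer_selfadjoint x : outer x x \in selfadjoint_pred.
Proof.
by apply/asboolP => y z /=; rewrite inner_ractl inner_ract inner_conj.
Qed.

(* x x^* *)
Definition outer_sa x : saop := SAOp (outer_selfadjoint x).

Lemma re_hsC A B : re_hs A B = re_hs B A.
Proof. by apply: eq_bigr => e _; rewrite re_innerC. Qed.

Lemma re_hsDl A B C : re_hs (A + B) C = re_hs A C + re_hs B C.
Proof.
by rewrite -big_split; apply: eq_bigr => e _; rewrite /re_inner /= innerDl raddfD.
Qed.

Lemma re_hsZl r A B : re_hs (r *: A) B = r * re_hs A B.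
Proof.
by rewrite /re_hs mulr_sumr; apply: eq_bigr => e _; rewrite /re_inner /= innerZl sReZ.
Qed.

Lemma re_hs_ge0 A : 0 <= re_hs A A.
Proof. by apply: sumr_ge0 => e _; rewrite /re_inner -inner_norm exprn_ge0. Qed.

Lemma re_hs_eq0 A : re_hs A A = 0 -> A = 0.
Proof.
move/eqP; rewrite psumr_eq0; last first.
  by move=> e _; rewrite /re_inner -inner_norm exprn_ge0.
move=> /allP A0; have Ae e : e \in onb V -> A e = 0.
  move=> /A0 /=; rewrite /re_inner -inner_norm expf_eq0 /=.
  by rewrite normr_eq0 => /eqP.
have A0' : A 0 = 0 by apply: (@addrI V (A 0)); rewrite -linopD !addr0.
apply/val_inj/funext => x /=; rewrite [x in LHS](proj2 (onbP V) x).
rewrite (big_morph A (linopD A) A0') big_seq big1// => e eo.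
by rewrite linop_ract Ae// ract0l.
Qed.

Lemma re_hs_cauchy_schwarz A B : re_hs A B ^+ 2 <= re_hs A A * re_hs B B.
Proof.
set a := re_hs A A; set b := re_hs B B; set c := re_hs A B.
have b0 : 0 <= b := re_hs_ge0 B.
have := re_hs_ge0 (b *: A + (- c) *: B).
rewrite !(re_hsDl, re_hsZl, re_hsC _ (_ + _)) (re_hsC B A) -/a -/b -/c.
have [bE _|b_neq0] := eqVneq b 0.
  by rewrite /c (re_hs_eq0 bE) re_hsC -(scale0r 0) re_hsZl mul0r bE expr0n mulr0.
have b_gt0 : 0 < b by rewrite lt0r b_neq0.
have -> : b * (b * a + - c * c) + - c * (b * c + - c * b) = b * (a * b - c ^+ 2).
  by ring.
by rewrite pmulr_rge0// subr_ge0.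
Qed.

Definition sa_norm (A : saop) : R := Num.sqrt (re_hs A A).

Let sa_norm_triangle (A B : saop) : sa_norm (A + B) <= sa_norm A + sa_norm B.
Proof.
have na := sqrtr_ge0 (re_hs A A); have nb := sqrtr_ge0 (re_hs B B).
rewrite -(@ler_pXn2r _ 2) ?nnegrE ?sqrtr_ge0 ?addr_ge0//.
rewrite sqrrD !sqr_sqrtr ?re_hs_ge0//= re_hsDl !(re_hsC _ (_ + _)) !re_hsDl.
rewrite (re_hsC B A).
suff : re_hs A B <= sa_norm A * sa_norm B by rewrite /sa_norm; lra.
apply: le_trans (ler_norm _) _.
rewrite -(@ler_pXn2r _ 2) ?nnegrE ?mulr_ge0//.
by rewrite real_normK ?num_real// exprMn !sqr_sqrtr ?re_hs_ge0// re_hs_cauchy_schwarz.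
Qed.

Let sa_normZ r (A : saop) : sa_norm (r *: A) = `|r| * sa_norm A.
Proof.
rewrite /sa_norm /= re_hsZl re_hsC re_hsZl mulrA -expr2.
by rewrite sqrtrM ?sqr_ge0// sqrtr_sqr.
Qed.

Let sa_norm_eq0 (A : saop) : sa_norm A = 0 -> A = 0.
Proof.
move=> /eqP; rewrite sqrtr_eq0 => A0; apply/val_inj/re_hs_eq0.
by apply/eqP; rewrite eq_le A0 re_hs_ge0.
Qed.

HB.instance Definition _ :=
  Lmodule_isNormed.Build R saop sa_norm_triangle sa_normZ sa_norm_eq0.

Lemma saop_normE (A : saop) : `|A| = Num.sqrt (re_hs A A).
Proof. by []. Qed.

End Operators.

Section Riemannian.
Variable R : realType.

(* Meant for [V] finite-dimensional and [U] open, where continuity of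
   x |-> 'd f x v for every v is continuity of x |-> 'd f x. *)
Fixpoint class_C (V W : normedModType R) (n : nat) (U : set V) (f : V -> W) : Prop :=
  match n with
  | 0 => forall x, U x -> {for x, continuous f}
  | n'.+1 => (forall x, U x -> differentiable f x) /\
             (forall v, class_C n' U (fun x => 'd f x v))
  end.

Definition smooth_on (V W : normedModType R) (U : set V) (f : V -> W) : Prop :=
  forall n, class_C n U f.

(* A metric on an open set U of V assigns to a point x the form [g x] on the
   tangent space at x, which is identified with V. *)
Record riemannian_metric (V : normedModType R) (U : set V) (g : V -> V -> V -> R) :
    Prop := RiemannianMetric {
  metric_linear : forall x, U x -> forall r u v w,
    g x (r *: u + v) w = r * g x u w + g x v w;
  metric_sym : forall x, U x -> forall v w, g x v w = g x w v;
  metric_pos : forall x, U x -> forall v, v != 0 -> 0 < g x v v;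
  metric_smooth : forall v w, smooth_on U (fun x => g x v w)
}.

Record smooth_embedding (V W : normedModType R) (U : set V) (F : V -> W) : Prop :=
    SmoothEmbedding {
  embedding_smooth : smooth_on U F;
  embedding_immersion : forall x, U x -> injective ('d F x);
  embedding_inj : forall x y, U x -> U y -> F x = F y -> x = y;
  (* F is open onto its image, hence a homeomorphism onto it *)
  embedding_open : forall A, open A -> A `<=` U ->
    exists2 B, open B & F @` A = B `&` (F @` U)
}.

Record isometric_embedding (V W : normedModType R)
    (U : set V) (g : V -> V -> V -> R) (U' : set W) (g' : W -> W -> W -> R)
    (F : V -> W) : Prop := IsometricEmbedding {
  isometric_source : riemannian_metric U g;
  isometric_target : riemannian_metric U' g';
  isometric_maps : forall x, U x -> U' (F x);
  isometric_smooth_embedding : smooth_embedding U F;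
  isometric_pullback : forall x, U x -> forall v w,
    g x v w = g' (F x) ('d F x v) ('d F x w)
}.

End Riemannian.

(* Main.v *)
Require Import Defs.
From HB Require Import structures.
From mathcomp Require Import all_boot all_order all_algebra.
From mathcomp Require Import all_classical all_reals all_analysis.
From mathcomp Require Import ring lra.

Set Implicit Arguments.
Unset Strict Implicit.
Unset Printing Implicit Defensive.

Import Order.TTheory GRing.Theory Num.Theory.
Import numFieldNormedType.Exports.

Local Open Scope classical_set_scope.
Local Open Scope ring_scope.

(** Write [r] for the norm of [x].  The map is
    [x |-> (r `^ (1/2), r `^ (- 1/2) *: x, r `^ (- 3/2) *: outer_sa x)], and its
    first component times its second is [x].  It therefore has
    the left inverse [(a, h, T) |-> a *: h], which is differentiable everywhere
    and makes it injective, an immersion, and open onto its image ([retraction_smooth_embedding]).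

    Smoothness away from 0 holds because the components are products of real
    powers of the norm with bilinear maps.  The derivative of [r `^ s] in the
    direction [v] is [s * r `^ (s - 2) * re_inner x v], of the same shape, so
    [class_C_norm_powR] follows by induction; [class_C_bilinear] is the Leibniz
    rule for bounded bilinear maps.  The operator component is handled through the
    bilinear map [sym_outer x y = (x y^* + y x^* ) / 2].

    It remains to compute the pullback ([embed_pullback]).  With
    [p = re_inner x v] and [s = re_inner x w], the three components contribute
      - [(1/4) p s / r^3], with weight 5/2;
      - [re_inner v w / r - (3/4) p s / r^3], with weight 1;
      - [2 re_inner v w / r + (1/4) p s / r^3 - 2 Re (<v,x><x,w>) / r^3], with
        weight 1/2.
    In the last line, [Re (<x,v><x,w>)] has been rewritten by
    [Re (<x,v><x,w>) + Re (<v,x><x,w>) = 2 p s], valid in all three algebras of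
    scalars ([sRe_conj_mulD]).  The terms [p s] cancel and the source metric is
    left.  The source is then a Riemannian metric because it is the pullback of
    one under an immersion ([pullback_isometric_embedding]). *)

(** * Functions of class C^n on an open set *)

Section Cn.
Variable R : realType.
Implicit Types V W : normedModType R.

(** The first-order expansion at [x] only sees a neighbourhood of [x]. *)
Lemma near_eq_is_diff V W (f g df : V -> W) (x : V) :
  (\forall y \near x, f y = g y) -> is_diff x f df -> is_diff x g df.
Proof.
move=> fg dfx; have dfx' : differentiable f x by [].
have fgx : f x = g x := nbhs_singleton fg.
have locg : g \o shift x = cst (g x) + 'd f x +o_ 0 id.
  have /eqaddoP fo := diff_locally dfx'.
  apply/eqaddoP => e e0; have := fo e e0.
  have fg0 : \forall y \near 0, f (y + x) = g (y + x).
    by move: fg; rewrite (near_shift 0) /= subr0.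
  by apply: filter_app; apply: filterS fg0 => y /= fgy; rewrite !fctE /= -fgy -fgx.
have dg : 'd g x = 'd f x :> (V -> W).
  exact: (diff_unique (diff_continuous dfx') locg).
apply: DiffDef; last by rewrite dg diff_val.
by apply/diff_locallyP; rewrite dg; split => //; exact: diff_continuous.
Qed.

Lemma eq_class_C V W n (U : set V) (f g : V -> W) : open U ->
  (forall x, U x -> f x = g x) -> class_C n U f -> class_C n U g.
Proof.
move=> oU; elim: n f g => [|n IH] f g fg /=.
  move=> Cf x Ux; have := Cf x Ux; rewrite /prop_for /continuous_at -(fg x Ux).
  apply: cvg_trans; apply: near_eq_cvg.
  by apply: filterS (open_nbhs_nbhs (conj oU Ux)) => y /fg.
move=> [df Cdf].
have dg x : U x -> is_diff x g ('d f x).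
  move=> Ux; apply: (@near_eq_is_diff _ _ f); last exact/differentiableP/df.
  by apply: filterS (open_nbhs_nbhs (conj oU Ux)) => y /fg.
split=> [x /dg []//|v]; apply: IH (Cdf v) => x Ux.
by have [_ ->] := dg x Ux.
Qed.

(** The functions [x |-> 'd f x v] have unspecified values outside [U]; taking
    any formula [df] valid on [U] instead is what makes the inductions on the
    order of differentiability below run. *)
Lemma class_C_diff V W n (U : set V) (f : V -> W) (df : V -> V -> W) :
  open U -> (forall x, U x -> is_diff x f (df x)) ->
  (forall v, class_C n U (fun x => df x v)) -> class_C n.+1 U f.
Proof.
move=> oU fdf Cdf; split=> [x /fdf []//|v].
by apply: eq_class_C (Cdf v) => // x /fdf [_ ->].
Qed.

Lemma class_CW V W n (U : set V) (f : V -> W) :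
  class_C n.+1 U f -> class_C n U f.
Proof.
elim: n f => [|n IH] f [df Cdf].
  by move=> x Ux; apply/differentiable_continuous/df.
by split=> // v; exact/IH/Cdf.
Qed.

Lemma class_C_cst V W n (U : set V) (c : W) : class_C n U (fun=> c).
Proof.
elim: n c => [|n IH] c; first by move=> x _; exact: cvg_cst.
split=> [x _|v]; first exact: differentiable_cst.
have -> : (fun x => 'd (fun=> c) x v) = (fun=> 0).
  by apply/funext => x; rewrite diff_cst.
exact: IH.
Qed.

Lemma class_C_id V n (U : set V) : class_C n U (fun x : V => x).
Proof.
case: n => [|n]; first by move=> x _; exact: cvg_id.
split=> [x _|v]; first by have [] := is_diff_id x.
have -> : (fun x => 'd (fun y : V => y) x v) = (fun=> v).
  by apply/funext => x; have [_ ->] := is_diff_id x.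
exact: class_C_cst.
Qed.

Lemma class_C_add V W n (U : set V) (f g : V -> W) : open U ->
  class_C n U f -> class_C n U g -> class_C n U (fun x => f x + g x).
Proof.
move=> oU; elim: n f g => [|n IH] f g.
  by move=> Cf Cg x Ux; apply: cvgD; [exact: Cf|exact: Cg].
move=> [df Cf] [dg Cg].
apply: (class_C_diff (df := fun x v => 'd f x v + 'd g x v)) => //.
  move=> x Ux.
  exact: (is_diffD (differentiableP (df x Ux)) (differentiableP (dg x Ux))).
by move=> v; exact: IH (Cf v) (Cg v).
Qed.

Lemma class_C_pair V W W' n (U : set V) (f : V -> W) (g : V -> W') : open U ->
  class_C n U f -> class_C n U g -> class_C n U (fun x => (f x, g x)).
Proof.
move=> oU; elim: n f g => [|n IH] f g.
  by move=> Cf Cg x Ux; apply: cvg_pair; [exact: Cf|exact: Cg].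
move=> [df Cf] [dg Cg].
apply: (class_C_diff (df := fun x v => ('d f x v, 'd g x v))) => //.
  move=> x Ux.
  exact: (is_diff_pair (differentiableP (df x Ux)) (differentiableP (dg x Ux))).
by move=> v; exact: IH (Cf v) (Cg v).
Qed.

Section Bilinear.
Variables (V1 V2 W : normedModType R) (B : {bilinear V1 -> V2 -> W}) (C : R).
Hypothesis B_bounded : forall x y, `|B x y| <= C * `|x| * `|y|.

Lemma bounded_bilinear_continuous : continuous (fun p : V1 * V2 => B p.1 p.2).
Proof.
move=> [a b]; apply/subr_cvg0; apply: norm_cvg0.
pose h (p : V1 * V2) := C * `|p.1 - a| * `|p.2| + C * `|a| * `|p.2 - b|.
have ha (p : V1 * V2) : 0 <= `|B p.1 p.2 - B a b| <= h p.
  rewrite normr_ge0 /= (_ : _ - _ = B (p.1 - a) p.2 + B a (p.2 - b)).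
    by rewrite (le_trans (ler_normD _ _))// lerD.
  by rewrite linearBl linearBr addrA subrK.
have h0 : h p @[p --> (a, b)] --> (0 : R).
  rewrite (_ : 0 = C * `|a - a| * `|b| + C * `|a| * `|b - b|); last first.
    by rewrite !subrr !normr0; ring.
  have norm_lim (X : normedModType R) (c : X) (f : V1 * V2 -> X) :
      f p @[p --> (a, b)] --> c -> `|f p| @[p --> (a, b)] --> (`|c| : R).
    exact: cvg_norm.
  apply: cvgD; apply: cvgM; do ?exact: cvg_cst.
  - apply: cvgM; first exact: cvg_cst.
    by apply: norm_lim; apply: cvgB; [exact: cvg_fst|exact: cvg_cst].
  - by apply: norm_lim; exact: cvg_snd.
  - by apply: norm_lim; apply: cvgB; [exact: cvg_snd|exact: cvg_cst].
have nha : \forall p \near (a, b), 0 <= `|B p.1 p.2 - B a b| <= h p.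
  by apply: filterE => p; exact: ha.
exact: squeeze_cvgr nha _ (cvg_cst (0 : R)) h0.
Qed.

Lemma is_diff_bilinear V (f df : V -> V1) (g dg : V -> V2) (x : V) :
  is_diff x f df -> is_diff x g dg ->
  is_diff x (fun y => B (f y) (g y)) (fun v => B (f x) (dg v) + B (df v) (g x)).
Proof.
move=> fx gx.
have dB : is_diff (f x, g x) (fun p => B p.1 p.2)
    (fun q => B (f x) q.2 + B q.1 (g x)).
  have cB := bounded_bilinear_continuous.
  by apply: DiffDef; [exact: differentiable_bilin|rewrite diff_bilin].
exact: (is_diff_comp (is_diff_pair fx gx) dB).
Qed.

(** The Leibniz rule expresses the derivative of a product by products of
    functions that are one order less regular; [class_CW] is needed because an
    undifferentiated factor remains in each term. *)
Lemma class_C_bilinear V n (U : set V) (f : V -> V1) (g : V -> V2) : open U ->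
  class_C n U f -> class_C n U g -> class_C n U (fun x => B (f x) (g x)).
Proof.
move=> oU; elim: n f g => [|n IH] f g.
  move=> Cf Cg x Ux.
  apply: (@continuous_comp _ _ _ (fun y => (f y, g y)) (fun p => B p.1 p.2)).
    by apply: cvg_pair; [exact: Cf|exact: Cg].
  exact: bounded_bilinear_continuous.
move=> CSf CSg; have Cf := class_CW CSf; have Cg := class_CW CSg.
case: CSf => df Cdf; case: CSg => dg Cdg.
apply: (class_C_diff
  (df := fun x v => B (f x) ('d g x v) + B ('d f x v) (g x))) => //.
  move=> x Ux; apply: is_diff_bilinear; apply/differentiableP; first exact: df.
  exact: dg.
by move=> v; apply: class_C_add => //; [exact: IH Cf (Cdg v)|exact: IH (Cdf v) Cg].
Qed.

End Bilinear.

End Cn.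

(** * Symmetric bilinear maps on a Hilbert space *)

Section ScalarLemmas.
Variables (R : realType) (k : scalar_kind).
Implicit Types a b : scalars R k.

(** The imaginary part of [a] is skew, so its square is nonpositive. *)
Lemma sRe_sqr_le a : sRe (a * a) <= sRe a ^+ 2.
Proof.
case: k a => //= [[p q]|[p q r s]] /=; first by rewrite -subr_ge0; nra.
by rewrite -subr_ge0; nra.
Qed.

(** [a + sconj a] is the real number twice [sRe a].  In the pullback this absorbs
    the noncommutative cross term of the operator part. *)
Lemma sRe_conj_mulD a b : sRe (a * b) + sRe (sconj a * b) = 2 * sRe a * sRe b.
Proof.
by case: k a b => //= [a b|[? ?] [? ?]|[? ? ? ?] [? ? ? ?]] /=; ring.
Qed.

End ScalarLemmas.

Section Hilbert.
Variables (R : realType) (k : scalar_kind) (V : finHilbertType R k).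
Implicit Types (x y z v w : V) (r : R).

Lemma re_inner_norm x : re_inner x x = `|x| ^+ 2.
Proof. by rewrite inner_norm. Qed.

Lemma re_innerDr x y z : re_inner x (y + z) = re_inner x y + re_inner x z.
Proof. by rewrite /re_inner innerDr raddfD. Qed.

Lemma re_innerZr r x y : re_inner x (r *: y) = r * re_inner x y.
Proof. by rewrite /re_inner innerZr sReZ. Qed.

Lemma re_innerDl x y z : re_inner (x + y) z = re_inner x z + re_inner y z.
Proof. by rewrite !(re_innerC _ z) re_innerDr. Qed.

Lemma re_innerZl r x y : re_inner (r *: x) y = r * re_inner x y.
Proof. by rewrite !(re_innerC _ y) re_innerZr. Qed.

Lemma re_inner_bilinear : bilinear_for *%R *%R (@re_inner R k V).
Proof.
split=> [y r u v|x r u v]; last by rewrite re_innerDr re_innerZr.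
by rewrite re_innerDl re_innerZl.
Qed.

HB.instance Definition _ := bilinear_isBilinear.Build R V V R _ _
  (@re_inner R k V) re_inner_bilinear.

(** Cauchy-Schwarz, by expanding the square of the norm of
    [`|y| ^+ 2 *: x - re_inner x y *: y]. *)
Lemma re_inner_bounded x y : `|re_inner x y| <= 1 * `|x| * `|y|.
Proof.
rewrite mul1r -(@ler_pXn2r _ 2) ?nnegrE ?mulr_ge0// real_normK ?num_real//.
rewrite exprMn; have [->|y0] := eqVneq y 0.
  by rewrite normr0 -(scale0r y) re_innerZr mul0r !expr0n mulr0.
set c := re_inner x y; have y2 : 0 < `|y| ^+ 2 by rewrite exprn_gt0// normr_gt0.
have := sqr_ge0 `| (`|y| ^+ 2 *: x + (- c) *: y) |.
rewrite -(re_inner_norm (_ + _)) !(re_innerDr, re_innerDl, re_innerZr, re_innerZl).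
rewrite (re_innerC y) !re_inner_norm -/c.
rewrite (_ : _ + _ = `|y| ^+ 2 * (`|x| ^+ 2 * `|y| ^+ 2 - c ^+ 2)); last by ring.
by rewrite pmulr_rge0// subr_ge0.
Qed.

Lemma sym_outer_subproof x y :
  2^-1 *: (outer x y + outer y x) \in @selfadjoint_pred R k V.
Proof.
apply/asboolP => z w /=.
rewrite innerZl innerZr innerDl innerDr !inner_ractl !inner_ract !inner_conj.
by rewrite [in RHS]addrC.
Qed.

(** The polarization of [x |-> x x^*].  The operator [x y^*] alone is not
    self-adjoint, so the derivative of [outer_sa] has to be written with this
    symmetrized product. *)
Definition sym_outer x y : saop V := SAOp (sym_outer_subproof x y).

Lemma sym_outerC x y : sym_outer x y = sym_outer y x.
Proof. by apply/val_inj; rewrite /= addrC. Qed.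

Lemma sym_outer_self x : sym_outer x x = outer_sa x.
Proof.
apply/val_inj => /=.
rewrite -[in LHS](scale1r (outer x x)) -scalerDl scalerA.
by rewrite (_ : _ * _ = 1) ?scale1r//; field.
Qed.

Lemma sym_outerDl x y z : sym_outer (x + y) z = sym_outer x z + sym_outer y z.
Proof.
apply/val_inj/val_inj/funext => u /=.
rewrite !addrfctE !scalrfctE /= -scalerDr ractDl innerDl ractDr.
by congr (_ *: _); rewrite addrACA.
Qed.

Lemma sym_outerZl r x z : sym_outer (r *: x) z = r *: sym_outer x z.
Proof.
apply/val_inj/val_inj/funext => u /=.
rewrite !addrfctE !scalrfctE /= ractZ innerZl -ractA ract_real ractZ.
by rewrite scalerA mulrC -scalerA -!scalerDr.
Qed.

Lemma sym_outer_bilinear : bilinear_for *:%R *:%R sym_outer.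
Proof.
split=> [y|x] r u v; first by rewrite sym_outerDl sym_outerZl.
by rewrite !(sym_outerC x) sym_outerDl sym_outerZl.
Qed.

HB.instance Definition _ := bilinear_isBilinear.Build R V V (saop V) _ _
  sym_outer sym_outer_bilinear.

Lemma re_hs_sym_outer x v y w :
  re_hs (sym_outer x v) (sym_outer y w) =
  4^-1 * (sRe (inner x y * inner w v) + sRe (inner x w * inner y v) +
          (sRe (inner v y * inner w x) + sRe (inner v w * inner y x))).
Proof.
rewrite /= re_hsZl re_hsC re_hsZl re_hsDl !(re_hsC _ (_ + _)) !re_hsDl !re_hs_outer.
by field.
Qed.

(** The squared norm is half of [`|x| ^+ 2 * `|y| ^+ 2] plus half of
    [sRe (inner x y * inner x y)], and the latter is at most [re_inner x y ^+ 2];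
    Cauchy-Schwarz does the rest. *)
Lemma sym_outer_bounded x y : `|sym_outer x y| <= 1 * `|x| * `|y|.
Proof.
rewrite mul1r -(@ler_pXn2r _ 2) ?nnegrE ?mulr_ge0// exprMn.
rewrite saop_normE sqr_sqrtr ?re_hs_ge0// re_hs_sym_outer !inner_self.
have cs : re_inner x y ^+ 2 <= `|x| ^+ 2 * `|y| ^+ 2.
  rewrite -exprMn -[leRHS]mul1r -(expr1n _ 2) -exprMn mulrA.
  by rewrite -real_normK ?num_real// ler_pXn2r ?nnegrE ?mulr_ge0// re_inner_bounded.
have xy := sRe_sqr_le (inner x y); have yx := sRe_sqr_le (inner y x).
rewrite -/(re_inner y x) re_innerC in yx; rewrite -/(re_inner x y) in xy.
rewrite -!srealM !sRe_real.
move: cs xy yx; move: (sRe _) (sRe _) (re_inner x y ^+ 2) => a b c.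
move=> *; nra.
Qed.

End Hilbert.

(** * Products with a scalar function, and projections *)

Lemma scale_bilinear (R : realType) (W : normedModType R) :
  bilinear_for *:%R *:%R (@GRing.scale R W : R -> W -> W).
Proof.
split=> [w r s t|r s u v]; first by rewrite scalerDl -scalerA.
have := scalerA (s : R) (r : R) u; rewrite (mulrC (s : R)) -scalerA => sru.
by rewrite scalerDr; congr (_ + _); exact: esym sru.
Qed.

HB.instance Definition _ (R : realType) (W : normedModType R) :=
  bilinear_isBilinear.Build R R W W _ _ (@GRing.scale R W : R -> W -> W)
    (@scale_bilinear R W).

Lemma scale_bounded (R : realType) (W : normedModType R) (r : R) (w : W) :
  `|r *: w| <= 1 * `|r| * `|w|.
Proof. by rewrite normrZ mul1r. Qed.

Lemma is_diff_scale (R : realType) (V W : normedModType R) (f df : V -> R)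
    (g dg : V -> W) (x : V) :
  is_diff x f df -> is_diff x g dg ->
  is_diff x (fun y => f y *: g y) (fun v => f x *: dg v + df v *: g x).
Proof. exact: (is_diff_bilinear (@scale_bounded R W)). Qed.

Lemma class_C_scale (R : realType) (V W : normedModType R) n (U : set V)
    (f : V -> R) (g : V -> W) : open U ->
  class_C n U f -> class_C n U g -> class_C n U (fun x => f x *: g x).
Proof. exact: (class_C_bilinear (@scale_bounded R W)). Qed.

Lemma differentiable_fst (R : realType) (V W : normedModType R) (p : V * W) :
  differentiable (fst : V * W -> V) p.
Proof. by apply: linear_differentiable => q; exact: cvg_fst. Qed.

Lemma differentiable_snd (R : realType) (V W : normedModType R) (p : V * W) :
  differentiable (snd : V * W -> W) p.
Proof. by apply: linear_differentiable => q; exact: cvg_snd. Qed.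

(** * Real powers of the norm *)

Lemma neq0_open (R : realType) (V : normedModType R) : open [set x : V | x != 0].
Proof.
have -> : [set x : V | x != 0] = ~` [set 0].
  by apply/seteqP; split=> x /= /eqP.
apply: closed_openC; apply: accessible_closed_set1.
exact/hausdorff_accessible/norm_hausdorff.
Qed.

Section NormPower.
Variables (R : realType) (k : scalar_kind) (V : finHilbertType R k).
Implicit Types (x v : V) (s : R).

Lemma is_diff_powR (a t : R) : 0 < t ->
  is_diff t (fun u : R => u `^ a) (fun h => a * t `^ (a - 1) * h).
Proof.
move=> t0; have [da Da] := is_derive1_powR a t0.
have dt : differentiable (fun u : R => u `^ a) t by apply/derivable1_diffP.
apply: DiffDef => //; rewrite diff1E// derive1E Da.
by apply/funext => h; exact: mulrC.
Qed.

(** Real powers of the norm are differentiated through the squared norm, which is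
    the restriction of a bilinear map to the diagonal. *)
Lemma powR_re_inner s x : `|x| `^ s = re_inner x x `^ (s / 2).
Proof.
by rewrite re_inner_norm -powR_mulrn// -powRrM mulrC divfK// pnatr_eq0.
Qed.

Lemma is_diff_norm_powR s x : x != 0 ->
  is_diff x (fun y => `|y| `^ s)
    (fun v => s * `|x| `^ (s - 2) * re_inner x v).
Proof.
move=> x0; have -> : (fun y : V => `|y| `^ s) = (fun y => re_inner y y `^ (s / 2)).
  by apply/funext => y; rewrite powR_re_inner.
have rx : 0 < re_inner x x by rewrite re_inner_norm exprn_gt0 ?normr_gt0.
have dr := is_diff_bilinear (@re_inner_bounded R k V) (is_diff_id x) (is_diff_id x).
apply: is_diff_eq (is_diff_comp dr (is_diff_powR (s / 2) rx)) _.
apply/funext => v /=; rewrite (re_innerC v) powR_re_inner.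
rewrite (_ : (s - 2) / 2 = s / 2 - 1); last by field.
by field.
Qed.

(** The family of all real powers is stable under differentiation up to the
    factors [s] and [re_inner x v], so one induction on [n] treats all [s]. *)
Lemma class_C_norm_powR n s : class_C n [set x : V | x != 0] (fun x => `|x| `^ s).
Proof.
have oU := @neq0_open R V; elim: n s => [|n IH] s.
  move=> x /= x0; apply: differentiable_continuous.
  by have [] := is_diff_norm_powR s x0.
apply: (class_C_diff oU) => [x|v]; first exact: is_diff_norm_powR.
have ->: (fun x => s * `|x| `^ (s - 2) * re_inner x v) =
   (fun x => (s *: `|x| `^ (s - 2)) *: (re_inner x v : R)) by [].
apply: (class_C_scale oU).
  exact: class_C_scale oU (class_C_cst _ _ _) (IH _).
apply: (class_C_bilinear (@re_inner_bounded R k V)) => //.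
- exact: class_C_id.
- exact: class_C_cst.
Qed.

End NormPower.

(** * Embeddings into a space with a constant metric *)

Section Embeddings.
Variables (R : realType) (V W : normedModType R).

(** A left inverse [G] gives everything at once: injectivity, immersion by the
    chain rule applied to [G \o F], and openness onto the image because the image
    of [A] is cut out by the open set [G @^-1` A]. *)
Lemma retraction_smooth_embedding (U : set V) (F : V -> W) (G : W -> V) :
  open U -> smooth_on U F -> (forall y, differentiable G y) ->
  (forall x, U x -> G (F x) = x) -> smooth_embedding U F.
Proof.
move=> oU sF dG GF; split => //.
- move=> x Ux.
  have [dF _] := sF 1.
  have dGF : is_diff x id ('d G (F x) \o 'd F x).
    apply: (@near_eq_is_diff _ _ _ (G \o F)).
      by apply: filterS (open_nbhs_nbhs (conj oU Ux)) => y /GF.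
    exact: is_diff_comp (differentiableP (dF x Ux)) (differentiableP (dG _)).
  have idE : 'd G (F x) \o 'd F x = id.
    rewrite -(@diff_val _ _ _ _ _ _ _ dGF).
    exact: (@diff_val _ _ _ _ _ _ _ (is_diff_id x)).
  by move=> v w vw; rewrite -[v]/(id v) -[w]/(id w) -idE /= vw.
- by move=> x y Ux Uy Fxy; rewrite -(GF x Ux) Fxy GF.
- move=> A oA AU; exists (G @^-1` A).
    by apply: open_comp oA => y _; exact: differentiable_continuous.
  apply/seteqP; split=> [_ [x Ax <-]|y [Ay [x Ux xy]]].
    have Ux := AU x Ax; split; last by exists x.
    by rewrite /preimage /= GF.
  by exists x => //; move: Ay; rewrite /preimage /= -xy GF.
Qed.

Variables (B : {bilinear W -> W -> R}) (C : R).
Hypothesis B_bounded : forall a b, `|B a b| <= C * `|a| * `|b|.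
Hypothesis B_sym : forall a b, B a b = B b a.
Hypothesis B_pos : forall a, a != 0 -> 0 < B a a.

Lemma bilinear_riemannian_metric :
  riemannian_metric setT (fun _ => (B : W -> W -> R)).
Proof.
split=> [x _ r u v w|x _ v w|x _ v|v w n].
- by rewrite linearDl linearZl_LR.
- exact: B_sym.
- exact: B_pos.
- exact: class_C_cst.
Qed.

(** The metric axioms for [g] are inherited from [B]: positivity holds because
    [F] is an immersion, and smoothness because [x |-> 'd F x v] is smooth. *)
Lemma pullback_isometric_embedding (U : set V) (g : V -> V -> V -> R) (F : V -> W) :
  open U -> smooth_embedding U F ->
  (forall x, U x -> forall v w, g x v w = B ('d F x v) ('d F x w)) ->
  isometric_embedding U g setT (fun _ => (B : W -> W -> R)) F.
Proof.
move=> oU emb gE; have [sF imm inj _] := emb; split => //; last first.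
  exact: bilinear_riemannian_metric.
split=> [x Ux r u v w|x Ux v w|x Ux v v0|v w n].
- by rewrite !gE// linearD linearZ linearDl linearZl_LR.
- by rewrite !gE// B_sym.
- rewrite gE//; apply: B_pos; apply: contra v0 => /eqP dv0.
  by apply/eqP/(imm x Ux); rewrite dv0 linear0.
- apply: (@eq_class_C _ _ _ _ _ (fun x => B ('d F x v) ('d F x w))) => //.
    by move=> x Ux; rewrite gE.
  have [_ dF] := sF n.+1.
  by apply: (class_C_bilinear B_bounded); [|exact: dF|exact: dF].
Qed.

End Embeddings.

(** * The target metric *)

Section Target.
Variables (R : realType) (k : scalar_kind) (V : finHilbertType R k).
Local Notation W := (R * V * saop V)%type.

Definition target_metric (a b : W) : R :=
  5 / 2 * (a.1.1 * b.1.1) + re_inner a.1.2 b.1.2 + 1 / 2 * re_hs a.2 b.2.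

Lemma target_metric_sym a b : target_metric a b = target_metric b a.
Proof. by rewrite /target_metric re_innerC re_hsC (mulrC a.1.1). Qed.

Lemma target_metric_bilinear : bilinear_for *%R *%R target_metric.
Proof.
have lin b : linear_for *%R (target_metric^~ b).
  move=> r u v; rewrite /target_metric /= re_innerDl re_innerZl re_hsDl re_hsZl.
  have -> : r *: u.1.1 = r * u.1.1 by [].
  by ring.
split=> // a r u v.
by rewrite !(target_metric_sym a) lin.
Qed.

HB.instance Definition _ := bilinear_isBilinear.Build R W W R _ _
  target_metric target_metric_bilinear.

Lemma re_hs_bounded (A B : saop V) : `|re_hs A B| <= `|A| * `|B|.
Proof.
rewrite -(@ler_pXn2r _ 2) ?nnegrE ?mulr_ge0// real_normK ?num_real//.
by rewrite exprMn !saop_normE !sqr_sqrtr ?re_hs_ge0// re_hs_cauchy_schwarz.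
Qed.

Lemma target_metric_bounded a b : `|target_metric a b| <= 4 * `|a| * `|b|.
Proof.
have fst_le (X Y : normedModType R) (p : X * Y) : `|p.1| <= `|p|.
  by rewrite [leRHS]prod_normE le_max lexx.
have snd_le (X Y : normedModType R) (p : X * Y) : `|p.2| <= `|p|.
  by rewrite [leRHS]prod_normE le_max lexx orbT.
have a11 : `|a.1.1| <= `|a| := le_trans (fst_le _ _ _) (fst_le _ _ _).
have b11 : `|b.1.1| <= `|b| := le_trans (fst_le _ _ _) (fst_le _ _ _).
have a12 : `|a.1.2| <= `|a| := le_trans (snd_le _ _ _) (fst_le _ _ _).
have b12 : `|b.1.2| <= `|b| := le_trans (snd_le _ _ _) (fst_le _ _ _).
have e1 : `|a.1.1 * b.1.1| <= `|a| * `|b| by rewrite normrM ler_pM.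
have e2 : `|re_inner a.1.2 b.1.2| <= `|a| * `|b|.
  by rewrite (le_trans (re_inner_bounded _ _))// mul1r ler_pM.
have e3 : `|re_hs a.2 b.2| <= `|a| * `|b|.
  by rewrite (le_trans (re_hs_bounded _ _))// ler_pM ?snd_le.
move: e1 e2 e3; rewrite /target_metric -(mulrA 4).
move: (a.1.1 * b.1.1) (re_inner _ _) (re_hs _ _) (`|a| * `|b| : R) => s t u m.
rewrite !ler_norml => /andP[? ?] /andP[? ?] /andP[? ?]; apply/andP; split; lra.
Qed.

Lemma target_metric_pos a : a != 0 -> 0 < target_metric a a.
Proof.
move=> a0; have s0 := sqr_ge0 a.1.1; have t0 := sqr_ge0 `|a.1.2|.
have u0 := re_hs_ge0 a.2.
rewrite lt_neqAle /target_metric re_inner_norm -expr2.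
apply/andP; split; last by lra.
apply: contra a0 => /eqP e0; apply/eqP.
have /eqP : a.1.1 ^+ 2 = 0 by lra.
have /eqP : `|a.1.2| ^+ 2 = 0 by lra.
have /re_hs_eq0 a20 : re_hs a.2 a.2 = 0 by lra.
rewrite !expf_eq0 /= normr_eq0 => /eqP a12 /eqP a11.
move: a11 a12 a20 {s0 t0 u0 e0}; case: a => [[r x] A] /= -> -> A0.
by congr (_, _, _); exact: val_inj.
Qed.

End Target.

(** * The embedding and its pullback *)

Section NormPowerEmbedding.
Variables (R : realType) (k : scalar_kind) (V : finHilbertType R k).
Implicit Types (x v w : V) (r : R).
Local Notation W := (R * V * saop V)%type.

Lemma powR_half_inv r n : 0 <= r -> r `^ (- (n%:R / 2)) = Num.sqrt r ^- n.
Proof.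
move=> r0; rewrite -mulNr mulrC powRrM powR12_sqrt//.
by rewrite powR_invn ?sqrtr_ge0.
Qed.

(** The map of the theorem with each component gathered into a single real power
    of the norm, so that [is_diff_norm_powR] differentiates it. *)
Definition embed x : W :=
  (`|x| `^ 2^-1, `|x| `^ (- (1 / 2)) *: x, `|x| `^ (- (3 / 2)) *: outer_sa x).

Lemma embedE x :
  Num.sqrt `|x| *: (1, `|x|^-1 *: x, `|x| ^- 2 *: outer_sa x) = embed x.
Proof.
rewrite /embed powR12_sqrt// (@powR_half_inv _ 1)// (@powR_half_inv _ 3)//.
(* With the convention that the inverse of 0 is 0, both sides vanish at 0. *)
have [->|x0] := eqVneq x 0.
  by rewrite normr0 sqrtr0 scale0r expr1 !invr0 !scale0r exprS mul0r invr0 scale0r.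
have q0 : Num.sqrt `|x| != 0 by rewrite sqrtr_eq0 -ltNge normr_gt0.
have -> : `|x| = Num.sqrt `|x| ^+ 2 by rewrite sqr_sqrtr.
rewrite sqrtr_sqr ger0_norm ?sqrtr_ge0//.
congr (_, _, _); rewrite /= ?scalerA.
- exact: mulr1.
- by congr (_ *: _); field.
- by congr (_ *: _); field.
Qed.

Lemma is_diff_outer_sa x :
  is_diff x (@outer_sa R k V) (fun v => sym_outer x v + sym_outer v x).
Proof.
have -> : @outer_sa R k V = fun y => sym_outer y y.
  by apply/funext => y; rewrite sym_outer_self.
exact: (is_diff_bilinear (@sym_outer_bounded R k V) (is_diff_id x) (is_diff_id x)).
Qed.

Lemma class_C_outer_sa n : class_C n [set x : V | x != 0] (@outer_sa R k V).
Proof.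
have -> : @outer_sa R k V = fun y => sym_outer y y.
  by apply/funext => y; rewrite sym_outer_self.
apply: (class_C_bilinear (@sym_outer_bounded R k V)); first exact: neq0_open.
  exact: class_C_id.
exact: class_C_id.
Qed.

Lemma embed_smooth : smooth_on [set x : V | x != 0] embed.
Proof.
have oU := @neq0_open R V.
move=> n; apply: (class_C_pair oU).
  apply: (class_C_pair oU); first exact: class_C_norm_powR.
  by apply: (class_C_scale oU); [exact: class_C_norm_powR|exact: class_C_id].
by apply: (class_C_scale oU); [exact: class_C_norm_powR|exact: class_C_outer_sa].
Qed.

(** All powers of the norm are written as integer powers of [q], the square root
    of the norm, so that the pullback becomes an identity of rational functions. *)
Lemma diff_embed x v (q := Num.sqrt `|x|) : x != 0 -> 'd embed x v =
  (2^-1 * q ^- 3 * re_inner x v,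
   q^-1 *: v + (- (2^-1) * q ^- 5 * re_inner x v) *: x,
   q ^- 3 *: (sym_outer x v + sym_outer x v) +
   (- (3 / 2) * q ^- 7 * re_inner x v) *: outer_sa x).
Proof.
move=> x0.
have d s := is_diff_norm_powR s x0.
have [_ ->] := is_diff_pair (is_diff_pair (d 2^-1)
  (is_diff_scale (d (- (1 / 2))) (is_diff_id x)))
  (is_diff_scale (d (- (3 / 2))) (is_diff_outer_sa x)).
rewrite /= (_ : 2^-1 - 2 = - (3%:R / 2)); last by field.
rewrite (_ : - (1 / 2) - 2 = - (5%:R / 2)); last by field.
rewrite (_ : - (3 / 2) - 2 = - (7%:R / 2)); last by field.
rewrite (@powR_half_inv _ 1)// (@powR_half_inv _ 3)// (@powR_half_inv _ 5)//.
rewrite (@powR_half_inv _ 7)// -/q (sym_outerC v x).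
by rewrite expr1 div1r.
Qed.

(** The product of [sym_outer x v] and [sym_outer x w] contains
    [sRe (inner x v * inner x w)]; [sRe_conj_mulD] trades it for
    [sRe (inner v x * inner x w)], the term of the source metric, at the price of
    [2 * p * s]. *)
Lemma re_hs_sym_outer_combination x v w (a b : R) :
  let p := re_inner x v in let s := re_inner x w in
  re_hs (a *: (sym_outer x v + sym_outer x v) + (b * p) *: outer_sa x)
        (a *: (sym_outer x w + sym_outer x w) + (b * s) *: outer_sa x) =
  2 * a ^+ 2 * (`|x| ^+ 2 * re_inner v w + 2 * p * s - sRe (inner v x * inner x w))
  + 4 * a * b * `|x| ^+ 2 * p * s + b ^+ 2 * `|x| ^+ 4 * p * s.
Proof.
move=> p s.
have expand (A B D : saop V) (t u : R) :
    re_hs (a *: (A + A) + t *: D) (a *: (B + B) + u *: D) =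
    4 * a ^+ 2 * re_hs A B + 2 * a * u * re_hs A D +
    2 * a * t * re_hs D B + t * u * re_hs D D.
  rewrite /= !(re_hsDl, re_hsZl).
  rewrite 2!(re_hsC _ (_ + _)) !(re_hsDl, re_hsZl).
  by rewrite (re_hsC B A) (re_hsC B D) (re_hsC D A); ring.
have xv : re_hs (sym_outer x v) (outer_sa x) = `|x| ^+ 2 * p.
  rewrite -sym_outer_self re_hs_sym_outer !inner_self -!sreal_comm !sReZ.
  by rewrite -!/(re_inner _ _) (re_innerC v) -/p; field.
have xw : re_hs (outer_sa x) (sym_outer x w) = `|x| ^+ 2 * s.
  rewrite -sym_outer_self re_hs_sym_outer !inner_self -!sreal_comm !sReZ.
  by rewrite -!/(re_inner _ _) (re_innerC w) -/s; field.
have xx : re_hs (outer_sa x) (outer_sa x) = `|x| ^+ 4.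
  by rewrite re_hs_outer !inner_self -srealM sRe_real -exprD.
have vw : re_hs (sym_outer x v) (sym_outer x w) =
    2^-1 * (`|x| ^+ 2 * re_inner v w + 2 * p * s - sRe (inner v x * inner x w)).
  rewrite re_hs_sym_outer !inner_self -!sreal_comm !sReZ -!/(re_inner _ _).
  rewrite (re_innerC w v).
  have := sRe_conj_mulD (inner x v) (inner x w).
  rewrite inner_conj -/(re_inner x v) -/(re_inner x w) -/p -/s.
  rewrite (sReMC (inner x w)) => <-.
  have -> : sRe (inner v x * inner w x) = sRe (inner x v * inner x w).
    by rewrite -sRe_conj sconjM !inner_conj sReMC.
  by field.
by rewrite expand vw xv xw xx; field.
Qed.

(** With the weights 5/2, 1, 1/2 the coefficients of
    [re_inner x v * re_inner x w / `|x| ^+ 3] cancel: the three components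
    contribute 5/8, -3/4 and 1/8. *)
Lemma embed_pullback x v w : x != 0 ->
  sRe (sreal k (2 / `|x|) * inner v w
       - sreal k (1 / `|x| ^+ 3) * (inner v x * inner x w)) =
  target_metric ('d embed x v) ('d embed x w).
Proof.
move=> x0; rewrite !diff_embed// raddfB /= !sReZ -/(re_inner v w).
set q := Num.sqrt `|x|.
have q0 : q != 0 by rewrite sqrtr_eq0 -ltNge normr_gt0.
have qE : `|x| = q ^+ 2 by rewrite sqr_sqrtr.
rewrite /target_metric /=.
have := re_hs_sym_outer_combination x v w (q ^- 3) (- (3 / 2) * q ^- 7).
rewrite /= => ->.
rewrite !(re_innerDl, re_innerDr, re_innerZl, re_innerZr) re_inner_norm qE.
rewrite (re_innerC v x).
move: (sRe _) (re_inner x v) (re_inner x w) (re_inner v w) => e p s t.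
by field.
Qed.
End NormPowerEmbedding.

Theorem lemma6p0p3 (R : realType) (k : scalar_kind) (H : finHilbertType R k) :
  @isometric_embedding R H (R * H * saop H)%type
    [set x : H | x != 0]
    (fun x v w =>
       sRe (sreal k (2 / `|x|) * inner v w
            - sreal k (1 / `|x| ^+ 3) * (inner v x * inner x w)))
    [set: (R * H * saop H)%type]
    (fun _ a b =>
       5 / 2 * (a.1.1 * b.1.1) + re_inner a.1.2 b.1.2 + 1 / 2 * re_hs a.2 b.2)
    (fun x => Num.sqrt `|x| *: (1, `|x|^-1 *: x, `|x| ^- 2 *: outer_sa x)).
Proof.
rewrite (funext (@embedE R k H)).
have oU := @neq0_open R H.
apply: (pullback_isometric_embedding (@target_metric_bounded R k H)
  (@target_metric_sym R k H) (@target_metric_pos R k H) oU); last first.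
  by move=> x x0 v w; exact: embed_pullback.
apply: (@retraction_smooth_embedding R H (R * H * saop H)%type _ _
  (fun p : R * H * saop H => p.1.1 *: p.1.2) oU) => //.
- exact: embed_smooth.
- move=> p; have d1 := @differentiable_fst _ (R * H)%type (saop H) p.
  have d11 := differentiable_comp d1 (@differentiable_fst _ R H p.1).
  have d12 := differentiable_comp d1 (@differentiable_snd _ R H p.1).
  by have [] := is_diff_scale (differentiableP d11) (differentiableP d12).
- move=> x /= x0; rewrite scalerA powR12_sqrt// (@powR_half_inv _ _ 1)//.
  by rewrite expr1 divff ?scale1r// sqrtr_eq0 -ltNge normr_gt0.
Qed.
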